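(* Let $g$, $H$, $\sigma$ satisfy conditions $(g)$, $(H_1)$, $(H_2)$, $(H_3)$, $(\sigma)$ listed in the context, and consider the Cauchy problem $$\text{(HJ)}\quad\partial^{ci}_{\tau,w}\varphi(\tau,z,w(\cdot))+\langle\partial^{ci}_{\tau,w}g(\tau,w(\cdot)),\nabla_z\varphi(\tau,z,w(\cdot))\rangle+H(\tau,z,w(-h),\nabla_z\varphi(\tau,z,w(\cdot)))=0,\quad(\tau,z,w(\cdot))\in\mathbb G_*,$$ $$\text{(T)}\quad\varphi(\vartheta,z,w(\cdot))=\sigma(z,w(\cdot)),\quad(z,w(\cdot))\in\mathbb R^n\times\mathrm{PLip}.$$ a) Let $\varphi\colon\mathbb G\to\mathbb R$ be the viscosity solution of problem (HJ), (T). If $\varphi$ is ci-differentiable at a point $(\tau,z,w(\cdot))\in\mathbb G_*$, then it satisfies equation (HJ) at this point. b) Let $\varphi\colon\mathbb G\to\mathbb R$ be ci-differentiable at every $(\tau,z,w(\cdot))\in\mathbb G_*$, satisfy equation (HJ) on $\mathbb G_*$, and satisfy conditions $(\varphi_1)$, $(\varphi_2)$ and (T). Then $\varphi$ is the viscosity solution of problem (HJ), (T).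
   Context: **Spaces.** Fix $n,I\in\mathbb N$ (positive), $h>0$, and $\vartheta=Ih$. A function $x(\cdot)$ from $[a,b)$ (or $[a,b]$) to $\mathbb R^n$ is piecewise Lipschitz continuous if there are points $a=\xi_1<\dots<\xi_k=b$ such that $x(\cdot)$ is Lipschitz continuous on each $[\xi_i,\xi_{i+1})$; the linear space of such functions is $\mathrm{PLip}([a,b),\mathbb R^n)$ (or $\mathrm{PLip}([a,b],\mathbb R^n)$). Put $\mathrm{PLip}=\mathrm{PLip}([-h,0),\mathbb R^n)$; $\mathrm{Lip}$ is the space of Lipschitz continuous functions $[-h,0)\to\mathbb R^n$; $\mathrm{PLip}_*$ is the set of $w(\cdot)\in\mathrm{PLip}$ for which there is $\delta_w>0$ such that $w(\cdot)$ is continuously differentiable on $[-h,-h+\delta_w]$. For $w(\cdot)\in\mathrm{PLip}$: $\|w(\cdot)\|_1=\int_{-h}^0\|w(\xi)\|d\xi$, $\|w(\cdot)\|_\infty=\sup_{\xi\in[-h,0)}\|w(\xi)\|$, $w(-0)=\lim_{\xi\to0-}w(\xi)$. Put $\mathbb G=[0,\vartheta]\times\mathbb R^n\times\mathrm{PLip}$, $\mathbb G_*=\bigcup_{i=0}^{I-1}(ih,(i+1)h)\times\mathbb R^n\times\mathrm{PLip}_*$, and $P(\alpha)=\{(z,w(\cdot))\in\mathbb R^n\times\mathrm{PLip}:\|z\|\le\alpha,\|w(\cdot)\|_\infty\le\alpha\}$. For $(\tau,z,w(\cdot))\in\mathbb G$, $\Lambda(\tau,z,w(\cdot))$ is the set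 of $x(\cdot)\in\mathrm{PLip}([\tau-h,\vartheta],\mathbb R^n)$ with $x(\tau)=z$ and $x(t)=w(t-\tau)$ for $t\in[\tau-h,\tau)$; $\Lambda_0(\tau,z,w(\cdot))$ is the subset (a single function) of those with $x(t)=z$ for all $t\in[\tau,\vartheta]$. For $t\in[\tau,\vartheta]$, $x_t(\cdot)\in\mathrm{PLip}$ is $x_t(\xi)=x(t+\xi)$, $\xi\in[-h,0)$. **Ci-differentiability.** $\varphi\colon\mathbb G\to\mathbb R$ is coinvariantly (ci-) differentiable at $(\tau,z,w(\cdot))\in\mathbb G$, $\tau<\vartheta$, if there exist $\partial^{ci}_{\tau,w}\varphi(\tau,z,w(\cdot))\in\mathbb R$ and $\nabla_z\varphi(\tau,z,w(\cdot))\in\mathbb R^n$ such that for every $t\in[\tau,\vartheta]$, $y\in\mathbb R^n$, $x(\cdot)\in\Lambda(\tau,z,w(\cdot))$, $$\varphi(t,y,x_t(\cdot))-\varphi(\tau,z,w(\cdot))=(t-\tau)\partial^{ci}_{\tau,w}\varphi(\tau,z,w(\cdot))+\langle y-z,\nabla_z\varphi(\tau,z,w(\cdot))\rangle+o(|t-\tau|+\|y-z\|),$$ where $o(\cdot)$ may depend on $x(\cdot)$ and $o(\delta)/\delta\to0$ as $\delta\to+0$. **Data.** $g\colon[0,\vartheta]\times\mathbb R^n\to\mathbb R^n$, $H\colon[0,\vartheta]\times\mathbb R^n\times\mathbb R^n\times\mathbb R^n\to\mathbb R$, $\sigma\colon\mathbb R^n\times\mathrm{PLip}\to\mathbb R$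 satisfy: $(g)$ $g$ is continuously differentiable. $(H_1)$ $H$ is continuous. $(H_2)$ There is $c_H>0$ with $|H(\tau,z,r,s)-H(\tau,z,r,s')|\le c_H(1+\|z\|+\|r\|)\|s-s'\|$ for all $\tau\in[0,\vartheta]$, $z,r,s,s'\in\mathbb R^n$. $(H_3)$ For every $\alpha>0$ there is $\lambda_H>0$ with $|H(\tau,z,r,s)-H(\tau,z',r',s)|\le\lambda_H(\|z-z'\|+\|r-r'\|)(1+\|s\|)$ for all $\tau\in[0,\vartheta]$, $z,r,z',r',s\in\mathbb R^n$ with $\max\{\|z\|,\|r\|,\|z'\|,\|r'\|\}\le\alpha$. $(\sigma)$ For every $\alpha>0$ there is $\lambda_\sigma>0$ with $|\sigma(z,w(\cdot))-\sigma(z',w'(\cdot))|\le\lambda_\sigma(\|z-z'\|+\|w(\cdot)-w'(\cdot)\|_1)$ for all $(z,w(\cdot)),(z',w'(\cdot))\in P(\alpha)$. For $(\tau,z,w(\cdot))\in\mathbb G_*$ put $\partial^{ci}_{\tau,w}g(\tau,w(\cdot))=\frac{\partial g}{\partial\tau}(\tau,w(-h))+\nabla_xg(\tau,w(-h))\frac{d^+w(-h)}{d\xi}$, where $\nabla_xg$ is the Jacobian matrix in the second variable and $d^+w(-h)/d\xi$ is the right derivative of $w$ at $-h$. **Conditions on $\varphi\colon\mathbb G\to\mathbb R$.** $(\varphi_1)$ For each $(\tau,w(\cdot))\in[0,\vartheta]\times\mathrm{Lip}$ the function $t\mapsto\varphi(t,w(-0),w(\cdot))$, $t\in[\tau,\vartheta]$,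 is continuous. $(\varphi_2)$ For every $\alpha>0$ there is $\lambda_\varphi>0$ with $|\varphi(\tau,z,w(\cdot))-\varphi(\tau,z',w'(\cdot))|\le\lambda_\varphi\,\upsilon(\tau,z-z',w(\cdot)-w'(\cdot))$ for all $\tau\in[0,\vartheta]$ and $(z,w(\cdot)),(z',w'(\cdot))\in P(\alpha)$, where $\upsilon(\tau,z,w(\cdot))=\|z\|+\|w(\cdot)\|_1+\|w(-h)\|+\|w(ih-\tau)\|$ and $i\in\{-1,0,\dots,I-1\}$ is such that $\tau\in(ih,(i+1)h]$. **Viscosity solution** of (HJ), (T): $\varphi$ satisfies $(\varphi_1)$, $(\varphi_2)$, (T), and, for all $(\tau,z,w(\cdot))\in\mathbb G_*$, $\psi\in C^1(\mathbb R\times\mathbb R^n,\mathbb R)$, $\delta>0$, with $\kappa(\cdot)\in\Lambda_0(\tau,z,w(\cdot))$ and $O^+_\delta(\tau,z)=\{(t,x)\in[\tau,\tau+\delta]\times\mathbb R^n:t\le\vartheta,\|x-z\|\le\delta\}$: (sub) if $\varphi(\tau,z,w(\cdot))-\psi(\tau,z)\le\varphi(t,x,\kappa_t(\cdot))-\psi(t,x)$ for all $(t,x)\in O^+_\delta(\tau,z)$, then $\frac{\partial\psi}{\partial\tau}(\tau,z)+\langle\partial^{ci}_{\tau,w}g(\tau,w(\cdot)),\nabla_z\psi(\tau,z)\rangle+H(\tau,z,w(-h),\nabla_z\psi(\tau,z))\le0$; (super) if $\varphi(\tau,z,w(\cdot))-\psi(\tau,z)\ge\varphi(t,x,\kappa_t(\cdot))-\psi(t,x)$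 for all $(t,x)\in O^+_\delta(\tau,z)$, then $\frac{\partial\psi}{\partial\tau}(\tau,z)+\langle\partial^{ci}_{\tau,w}g(\tau,w(\cdot)),\nabla_z\psi(\tau,z)\rangle+H(\tau,z,w(-h),\nabla_z\psi(\tau,z))\ge0$. Under the conditions above, the viscosity solution exists and is unique. *)

(* Defs.v *)
From HB Require Import structures.
From mathcomp Require Import all_boot all_order all_algebra.
From mathcomp Require Import all_classical all_reals all_analysis.

Set Implicit Arguments.
Unset Strict Implicit.
Unset Printing Implicit Defensive.

Import Order.TTheory GRing.Theory Num.Theory.
Import numFieldNormedType.Exports.

Local Open Scope classical_set_scope.
Local Open Scope ring_scope.

(* Vectors of R^n are row vectors. The library norm `|x| on 'rV[R]_n is the
   max-norm; it is used only for topological notions (limits, continuity,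
   differentiability, Lipschitz continuity), which do not depend on the choice
   of a norm. Every norm written explicitly in the theory is Euclidean. *)

Definition dot (R : realType) (n : nat) (u v : 'rV[R]_n) : R :=
  \sum_(i < n) u 0 i * v 0 i.

Definition enorm (R : realType) (n : nat) (u : 'rV[R]_n) : R :=
  Num.sqrt (dot u u).

(* Continuous differentiability on a set D that need not be open (a closed
   interval, or a closed strip): all increments are taken inside D, so that the
   derivatives are one-sided at the boundary of D. *)
Definition C1_on (R : realType) (U V : normedModType R) (D : set U)
    (f : U -> V) : Prop :=
  exists df : U -> {linear U -> V},
    (forall p, D p -> forall eps : R, 0 < eps ->
       \forall q \near within D (nbhs p),
         `|f q - f p - df p (q - p)| <= eps * `|q - p|)
    /\ (forall v, {within D, continuous (fun p => df p v)}).

Definition C1 (R : realType) (U V : normedModType R) (f : U -> V) : Prop :=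
  (forall p, differentiable f p) /\
  (forall v, continuous (fun p => 'd f p v)).

(* A function with domain D (an interval of R) is represented by its extension
   by zero to R: this representation is unique, so that functionals of such
   functions cannot depend on anything but the values on D. *)
Definition functions_on (R : realType) (n : nat) (D : set R) :
    set (R -> 'rV[R]_n) :=
  [set x | forall t, ~ D t -> x t = 0].

(* A partition a = xi_1 < ... < xi_k = b is given by s = [:: xi_2; ...; xi_k].
   Nothing is required at b itself, so the same condition serves for functions
   on [a, b) and on [a, b]. *)
Definition piecewise_lipschitz (R : realType) (n : nat) (a b : R)
    (x : R -> 'rV[R]_n) : Prop :=
  exists s : seq R, itv_partition a b s /\
    forall i, (i < size s)%N ->
      [lipschitz x t | t in `[nth b (a :: s) i, nth b (a :: s) i.+1[].

Definition PLip_co (R : realType) (n : nat) (a b : R) : set (R -> 'rV[R]_n) :=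
  [set x | functions_on `[a, b[ x /\ piecewise_lipschitz a b x].

Definition PLip_cc (R : realType) (n : nat) (a b : R) : set (R -> 'rV[R]_n) :=
  [set x | functions_on `[a, b] x /\ piecewise_lipschitz a b x].

Definition PLip (R : realType) (n : nat) (h : R) : set (R -> 'rV[R]_n) :=
  PLip_co (- h) 0.

Definition Lip (R : realType) (n : nat) (h : R) : set (R -> 'rV[R]_n) :=
  [set w | functions_on `[- h, 0[ w /\ [lipschitz w t | t in `[- h, 0[]].

Definition PLip_star (R : realType) (n : nat) (h : R) : set (R -> 'rV[R]_n) :=
  [set w | PLip h w /\
    exists delta : R, [/\ 0 < delta, delta < h &
      C1_on `[- h, - h + delta] w]].

Definition norm1 (R : realType) (n : nat) (h : R) (w : R -> 'rV[R]_n) : R :=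
  (\int[lebesgue_measure]_(xi in `[- h, 0%R[) enorm (w xi))%R.

Definition norm_infty (R : realType) (n : nat) (h : R) (w : R -> 'rV[R]_n) : R :=
  sup [set enorm (w xi) | xi in `[- h, 0[].

Definition left_lim0 (R : realType) (n : nat) (w : R -> 'rV[R]_n) : 'rV[R]_n :=
  lim (w xi @[xi --> 0^'-]).

Definition right_derivative (R : realType) (n : nat) (w : R -> 'rV[R]_n)
    (xi : R) : 'rV[R]_n :=
  lim (e^-1 *: (w (xi + e) - w xi) @[e --> 0^'+]).

Definition horizon (R : realType) (I : nat) (h : R) : R := I%:R * h.

Definition Gstar (R : realType) (n I : nat) (h : R) (tau : R) (z : 'rV[R]_n)
    (w : R -> 'rV[R]_n) : Prop :=
  (exists i : nat, (i < I)%N /\ i%:R * h < tau < i.+1%:R * h) /\ PLip_star h w.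

Definition P (R : realType) (n : nat) (h alpha : R) (z : 'rV[R]_n)
    (w : R -> 'rV[R]_n) : Prop :=
  [/\ PLip h w, enorm z <= alpha & norm_infty h w <= alpha].

Definition Lambda (R : realType) (n I : nat) (h : R) (tau : R) (z : 'rV[R]_n)
    (w : R -> 'rV[R]_n) : set (R -> 'rV[R]_n) :=
  [set x | [/\ PLip_cc (tau - h) (horizon I h) x, x tau = z &
    forall t, t \in `[tau - h, tau[ -> x t = w (t - tau)]].

Definition Lambda0 (R : realType) (n I : nat) (h : R) (tau : R) (z : 'rV[R]_n)
    (w : R -> 'rV[R]_n) : set (R -> 'rV[R]_n) :=
  [set x | Lambda I h tau z w x /\
    forall t, t \in `[tau, horizon I h] -> x t = z].

Definition segment_at (R : realType) (n : nat) (h : R) (x : R -> 'rV[R]_n)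
    (t : R) : R -> 'rV[R]_n :=
  patch (fun=> 0) `[- h, 0[ (fun xi => x (t + xi)).

(* A functional phi : [0, theta] x R^n x PLip -> R is represented by a function
   on R x 'rV[R]_n x (R -> 'rV[R]_n) whose values at other points are never
   used; similarly for g, H and sigma. *)

Definition is_ci_derivative (R : realType) (n I : nat) (h : R)
    (phi : R -> 'rV[R]_n -> (R -> 'rV[R]_n) -> R)
    (tau : R) (z : 'rV[R]_n) (w : R -> 'rV[R]_n) (p : R) (q : 'rV[R]_n) : Prop :=
  forall x, Lambda I h tau z w x ->
  forall eps : R, 0 < eps -> exists2 delta : R, 0 < delta &
  forall t (y : 'rV[R]_n), t \in `[tau, horizon I h] ->
    `|t - tau| + enorm (y - z) <= delta ->
    `|phi t y (segment_at h x t) - phi tau z w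
      - ((t - tau) * p + dot (y - z) q)| <= eps * (`|t - tau| + enorm (y - z)).

Definition ci_differentiable (R : realType) (n I : nat) (h : R)
    (phi : R -> 'rV[R]_n -> (R -> 'rV[R]_n) -> R)
    (tau : R) (z : 'rV[R]_n) (w : R -> 'rV[R]_n) : Prop :=
  exists (p : R) (q : 'rV[R]_n), is_ci_derivative I h phi tau z w p q.

(* The pair of derivatives is unique when 0 <= tau < theta and w is in PLip; if
   phi is not ci-differentiable at (tau, z, w), the value is a dummy. *)
Definition ci_derivatives (R : realType) (n I : nat) (h : R)
    (phi : R -> 'rV[R]_n -> (R -> 'rV[R]_n) -> R)
    (tau : R) (z : 'rV[R]_n) (w : R -> 'rV[R]_n) : R * 'rV[R]_n :=
  xget (0, 0) [set pq | is_ci_derivative I h phi tau z w pq.1 pq.2].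

Definition ci_dtau (R : realType) (n I : nat) (h : R)
    (phi : R -> 'rV[R]_n -> (R -> 'rV[R]_n) -> R)
    (tau : R) (z : 'rV[R]_n) (w : R -> 'rV[R]_n) : R :=
  (ci_derivatives I h phi tau z w).1.

Definition ci_grad (R : realType) (n I : nat) (h : R)
    (phi : R -> 'rV[R]_n -> (R -> 'rV[R]_n) -> R)
    (tau : R) (z : 'rV[R]_n) (w : R -> 'rV[R]_n) : 'rV[R]_n :=
  (ci_derivatives I h phi tau z w).2.

Definition cond_g (R : realType) (n I : nat) (h : R)
    (g : R -> 'rV[R]_n -> 'rV[R]_n) : Prop :=
  C1_on [set p : R * 'rV[R]_n | p.1 \in `[0, horizon I h]]
    (fun p => g p.1 p.2).

Definition cond_H1 (R : realType) (n I : nat) (h : R)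
    (H : R -> 'rV[R]_n -> 'rV[R]_n -> 'rV[R]_n -> R) : Prop :=
  {within [set p : R * 'rV[R]_n * 'rV[R]_n * 'rV[R]_n |
             p.1.1.1 \in `[0, horizon I h]],
   continuous (fun p : R * 'rV[R]_n * 'rV[R]_n * 'rV[R]_n =>
                 H p.1.1.1 p.1.1.2 p.1.2 p.2)}.

Definition cond_H2 (R : realType) (n I : nat) (h : R)
    (H : R -> 'rV[R]_n -> 'rV[R]_n -> 'rV[R]_n -> R) : Prop :=
  exists2 c : R, 0 < c &
  forall tau (z r s s' : 'rV[R]_n), tau \in `[0, horizon I h] ->
    `|H tau z r s - H tau z r s'|
      <= c * (1 + enorm z + enorm r) * enorm (s - s').

Definition cond_H3 (R : realType) (n I : nat) (h : R)
    (H : R -> 'rV[R]_n -> 'rV[R]_n -> 'rV[R]_n -> R) : Prop :=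
  forall alpha : R, 0 < alpha -> exists2 lambda : R, 0 < lambda &
  forall tau (z r z' r' s : 'rV[R]_n), tau \in `[0, horizon I h] ->
    [/\ enorm z <= alpha, enorm r <= alpha, enorm z' <= alpha &
        enorm r' <= alpha] ->
    `|H tau z r s - H tau z' r' s|
      <= lambda * (enorm (z - z') + enorm (r - r')) * (1 + enorm s).

Definition cond_sigma (R : realType) (n : nat) (h : R)
    (sigma : 'rV[R]_n -> (R -> 'rV[R]_n) -> R) : Prop :=
  forall alpha : R, 0 < alpha -> exists2 lambda : R, 0 < lambda &
  forall (z z' : 'rV[R]_n) (w w' : R -> 'rV[R]_n),
    P h alpha z w -> P h alpha z' w' ->
    `|sigma z w - sigma z' w'|
      <= lambda * (enorm (z - z') + norm1 h (w \- w')).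

(* The library jacobian acts on row vectors from the right: v *m jacobian f x
   is the usual matrix-vector product of the Jacobian matrix of f and v. At the
   points of Gstar, tau is interior to [0, theta], so the derivative in tau only
   depends on the values of g on [0, theta] x R^n. *)
Definition ci_deriv_g (R : realType) (n : nat) (h : R)
    (g : R -> 'rV[R]_n -> 'rV[R]_n) (tau : R) (w : R -> 'rV[R]_n) : 'rV[R]_n :=
  derive1 (fun t => g t (w (- h))) tau
  + right_derivative w (- h) *m jacobian (g tau) (w (- h)).

Definition HJ_lhs (R : realType) (n : nat) (h : R)
    (g : R -> 'rV[R]_n -> 'rV[R]_n)
    (H : R -> 'rV[R]_n -> 'rV[R]_n -> 'rV[R]_n -> R)
    (tau : R) (z : 'rV[R]_n) (w : R -> 'rV[R]_n) (p : R) (q : 'rV[R]_n) : R :=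
  p + dot (ci_deriv_g h g tau w) q + H tau z (w (- h)) q.

Definition HJ_at (R : realType) (n I : nat) (h : R)
    (g : R -> 'rV[R]_n -> 'rV[R]_n)
    (H : R -> 'rV[R]_n -> 'rV[R]_n -> 'rV[R]_n -> R)
    (phi : R -> 'rV[R]_n -> (R -> 'rV[R]_n) -> R)
    (tau : R) (z : 'rV[R]_n) (w : R -> 'rV[R]_n) : Prop :=
  HJ_lhs h g H tau z w (ci_dtau I h phi tau z w) (ci_grad I h phi tau z w) = 0.

Definition terminal_cond (R : realType) (n I : nat) (h : R)
    (sigma : 'rV[R]_n -> (R -> 'rV[R]_n) -> R)
    (phi : R -> 'rV[R]_n -> (R -> 'rV[R]_n) -> R) : Prop :=
  forall (z : 'rV[R]_n) (w : R -> 'rV[R]_n), PLip h w ->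
    phi (horizon I h) z w = sigma z w.

Definition cond_phi1 (R : realType) (n I : nat) (h : R)
    (phi : R -> 'rV[R]_n -> (R -> 'rV[R]_n) -> R) : Prop :=
  forall (tau : R) (w : R -> 'rV[R]_n), tau \in `[0, horizon I h] -> Lip h w ->
    {within `[tau, horizon I h], continuous (fun t => phi t (left_lim0 w) w)}.

Definition upsilon (R : realType) (n : nat) (h : R) (i : int) (tau : R)
    (z : 'rV[R]_n) (w : R -> 'rV[R]_n) : R :=
  enorm z + norm1 h w + enorm (w (- h)) + enorm (w (i%:~R * h - tau)).

(* For tau in [0, theta], the index i exists and is unique. *)
Definition cond_phi2 (R : realType) (n I : nat) (h : R)
    (phi : R -> 'rV[R]_n -> (R -> 'rV[R]_n) -> R) : Prop :=
  forall alpha : R, 0 < alpha -> exists2 lambda : R, 0 < lambda &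
  forall (tau : R) (i : int) (z z' : 'rV[R]_n) (w w' : R -> 'rV[R]_n),
    tau \in `[0, horizon I h] ->
    -1 <= i <= I%:Z - 1 -> i%:~R * h < tau <= (i + 1)%:~R * h ->
    P h alpha z w -> P h alpha z' w' ->
    `|phi tau z w - phi tau z' w'|
      <= lambda * upsilon h i tau (z - z') (w \- w').

Definition dtau_psi (R : realType) (n : nat) (psi : R * 'rV[R]_n -> R)
    (tau : R) (z : 'rV[R]_n) : R :=
  derive1 (fun t => psi (t, z)) tau.

Definition grad_psi (R : realType) (n : nat) (psi : R * 'rV[R]_n -> R)
    (tau : R) (z : 'rV[R]_n) : 'rV[R]_n :=
  \row_(i < n) 'D_(delta_mx 0 i) (fun y => psi (tau, y)) z.

Definition Oplus (R : realType) (n I : nat) (h delta tau : R) (z : 'rV[R]_n) :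
    set (R * 'rV[R]_n) :=
  [set p | [/\ p.1 \in `[tau, tau + delta], p.1 <= horizon I h &
               enorm (p.2 - z) <= delta]].

Definition viscosity_sub (R : realType) (n I : nat) (h : R)
    (g : R -> 'rV[R]_n -> 'rV[R]_n)
    (H : R -> 'rV[R]_n -> 'rV[R]_n -> 'rV[R]_n -> R)
    (phi : R -> 'rV[R]_n -> (R -> 'rV[R]_n) -> R) : Prop :=
  forall (tau : R) (z : 'rV[R]_n) (w : R -> 'rV[R]_n)
    (psi : R * 'rV[R]_n -> R) (delta : R) (kappa : R -> 'rV[R]_n),
    Gstar I h tau z w -> C1 psi -> 0 < delta -> Lambda0 I h tau z w kappa ->
    (forall t x, Oplus I h delta tau z (t, x) ->
       phi tau z w - psi (tau, z) <= phi t x (segment_at h kappa t) - psi (t, x)) ->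
    HJ_lhs h g H tau z w (dtau_psi psi tau z) (grad_psi psi tau z) <= 0.

Definition viscosity_super (R : realType) (n I : nat) (h : R)
    (g : R -> 'rV[R]_n -> 'rV[R]_n)
    (H : R -> 'rV[R]_n -> 'rV[R]_n -> 'rV[R]_n -> R)
    (phi : R -> 'rV[R]_n -> (R -> 'rV[R]_n) -> R) : Prop :=
  forall (tau : R) (z : 'rV[R]_n) (w : R -> 'rV[R]_n)
    (psi : R * 'rV[R]_n -> R) (delta : R) (kappa : R -> 'rV[R]_n),
    Gstar I h tau z w -> C1 psi -> 0 < delta -> Lambda0 I h tau z w kappa ->
    (forall t x, Oplus I h delta tau z (t, x) ->
       phi tau z w - psi (tau, z) >= phi t x (segment_at h kappa t) - psi (t, x)) ->
    HJ_lhs h g H tau z w (dtau_psi psi tau z) (grad_psi psi tau z) >= 0.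

Definition viscosity_solution (R : realType) (n I : nat) (h : R)
    (g : R -> 'rV[R]_n -> 'rV[R]_n)
    (H : R -> 'rV[R]_n -> 'rV[R]_n -> 'rV[R]_n -> R)
    (sigma : 'rV[R]_n -> (R -> 'rV[R]_n) -> R)
    (phi : R -> 'rV[R]_n -> (R -> 'rV[R]_n) -> R) : Prop :=
  [/\ cond_phi1 I h phi, cond_phi2 I h phi, terminal_cond I h sigma phi,
      viscosity_sub I h g H phi & viscosity_super I h g H phi].

(* Main.v *)
(** Along the constant extension kappa of w, ci-differentiability says that
    f(t, x) = phi(t, x, kappa_t) has a first-order expansion with coefficients
    (p, q) at (tau, z), one-sided in time.
    For (a), the remainder of the expansion is dominated near (tau, z) by a C^1
    function that vanishes there together with its derivative; subtracting it
    from (adding it to) the affine part of the expansion gives a test function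
    touching f from below (above) whose derivatives are exactly p and q, so both
    viscosity inequalities hold for (p, q).
    For (b), if a test function psi touches f from below, then comparing the
    increments along directions (dt, v) with dt >= 0 gives
    grad psi = q and dpsi/dtau <= p; the left-hand side of (HJ) is increasing
    in its first argument. The statements for touching from above follow by
    changing signs. *)
From HB Require Import structures.
Require Import Defs.
From mathcomp Require Import all_boot all_order all_algebra.
From mathcomp Require Import all_classical all_reals all_analysis.
From mathcomp Require Import lra ring.

Import Order.TTheory GRing.Theory Num.Theory.
Import numFieldNormedType.Exports.

Set Implicit Arguments.
Unset Strict Implicit.
Unset Printing Implicit Defensive.

Local Open Scope classical_set_scope.
Local Open Scope ring_scope.

(** * A C^1 majorant of a first-order remainder *)

(** With [F] a primitive of [m], the witness is [F s + F (- s)] normalised at 0. Evenness allows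
    [theta] to be applied to signed increments directly. As [m] vanishes on the negative half-line,
    the integral from -oo reduces to one over a compact interval. *)
Lemma C1_even_primitive (R : realType) (m : R -> R) :
  continuous m -> (forall s, s <= 0 -> m s = 0) ->
  exists theta : R -> R, [/\ theta 0 = 0, forall x, theta (- x) = theta x &
    forall x : R, is_derive x 1 theta (m x - m (- x))].
Proof.
move=> cm m0.
pose F x := (\int[lebesgue_measure]_(t in `]-oo, x]) m t)%R.
have intm u : lebesgue_measure.-integrable `]-oo, u] (EFin \o m).
  apply: (integrable_mkcond _ _).2 => //.
  have -> : (EFin \o m) \_ `]-oo, u] = (EFin \o m) \_ `[0, u].
    apply/funext => x; rewrite !patchE !mem_setE !in_itv/=.
    have [x0|x0]/= := leP 0 x; first by [].
    by case: ifP => //= _; rewrite m0// ltW.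
  apply: (integrable_mkcond _ _).1 => //.
  apply: (@continuous_compact_integrable R m `[0, u]%classic); first exact: segment_compact.
  by apply: continuous_subspaceT => x; exact: cm.
have dF (x : R) : is_derive x 1 F (m x).
  have xx1 : x < x + 1 by rewrite ltrDl.
  have [dF Fx] := @continuous_FTC1 R m -oo%O x _ xx1 (intm _) (ltNyr x) (cm x).
  by apply: DeriveDef => //; rewrite -derive1E.
exists (fun s => F s + F (- s) - (F 0 + F 0)); split.
- by rewrite oppr0 subrr.
- by move=> x; rewrite opprK (addrC (F (- x))).
move=> x.
have dN : is_derive x 1 (fun s : R => F (- s)) (- m (- x)).
  have := @is_derive1_comp R F (@GRing.opp R) x _ _ (dF (- x)) _.
  by move/(_ _ (is_deriveNid x 1)); rewrite mulrN1.
have := is_deriveB (is_deriveD (dF x) dN) (is_derive_cst (F 0 + F 0) x 1).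
by rewrite subr0.
Qed.

(** The hypothesis says r = o(N). The plain modulus, the supremum of |r| / N over N <= s, need not
    be continuous; a continuous nondecreasing [m] takes its place, and the integral of [m] is C^1.
    Monotonicity and evenness of [theta] will allow N to be replaced by coordinate increments. *)
Lemma C1_majorant (R : realType) (T : Type) (N r : T -> R) :
  (forall x, 0 <= N x) ->
  (forall e, 0 < e -> exists2 d, 0 < d &
     forall x, N x <= d -> `|r x| <= e * N x) ->
  exists theta dtheta : R -> R, exists2 d : R, 0 < d &
  [/\ theta 0 = 0 /\ dtheta 0 = 0,
      (forall x : R, is_derive x 1 theta (dtheta x)) /\
      (forall x, theta (- x) = theta x),
      continuous dtheta,
      forall x y, 0 <= x -> x <= y -> theta x <= theta y &
      forall x, N x <= d -> `|r x| <= theta (N x)].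
Proof.
move=> N0 rN.
(* m is the lower envelope of the affine functions e + s / d with
   |r| <= e N on {N <= d}: it is a subadditive modulus of continuity, whence its
   uniform continuity, and |r| <= N m(N) near N = 0. *)
pose A (e d : R) := [/\ 0 < e, 0 < d & forall x, N x <= d -> `|r x| <= e * N x].
pose S s := [set v : R | exists e d, A e d /\ v = e + Num.max 0 s / d].
pose m s := inf (S s).
have [d1 d1_gt0 rd1] := rN 1 ltr01.
have lbS s v : S s v -> 0 <= v.
  move=> [e [d [[e0 d0 _] ->]]]; apply: addr_ge0; first exact: ltW.
  by apply: divr_ge0; [rewrite le_max lexx|exact: ltW].
have nS s : S s !=set0 by exists (1 + Num.max 0 s / d1), 1, d1.
have iS s : has_inf (S s) by split => //; exists 0 => v /lbS.
have mle s e d : A e d -> m s <= e + Num.max 0 s / d.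
  by move=> Aed; apply: ge_inf; [exact: (iS s).2|exists e, d].
have lem s v : (forall e d, A e d -> v <= e + Num.max 0 s / d) -> v <= m s.
  by move=> H; apply: lb_le_inf => // _ [e [d [Aed ->]]]; exact: H.
have m_ge0 s : 0 <= m s by apply: lb_le_inf => // v /lbS.
have Ae e : 0 < e -> exists d, A e d.
  by move=> e0; have [d d0 dP] := rN e e0; exists d.
have m0 s : s <= 0 -> m s = 0.
  move=> s0; apply/eqP; rewrite eq_le m_ge0 andbT.
  apply/ler_addgt0Pr => e /Ae[d] /(mle s).
  by rewrite (max_idPl s0) mul0r addr0 add0r.
have mhomo s t : s <= t -> m s <= m t.
  move=> st; apply: lem => e d Aed; apply: (le_trans (mle _ _ _ Aed)).
  case: Aed => _ d0 _.
  rewrite lerD2l; apply: ler_wpM2r; first by rewrite invr_ge0 ltW.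
  by rewrite ge_max !le_max lexx st orbT.
(* The affine competitors have positive intercept e, so scaling the argument by k lowers their value
   at most by the factor k; the infimum inherits this. *)
have mscale k s : 0 <= k <= 1 -> k * m s <= m (k * s).
  move=> /andP[k0 k1]; apply: lem => e d Aed.
  have -> : Num.max 0 (k * s) = k * Num.max 0 s.
    by rewrite -[in LHS](mulr0 k) maxr_pMr.
  apply: (le_trans (ler_wpM2l k0 (mle s _ _ Aed))).
  by rewrite mulrDr mulrA lerD2r ler_piMl//; case: Aed => /ltW.
(* For s > 0, use [mscale] with the weights s / (s + t) and t / (s + t), which add up to 1. *)
have msub s t : 0 <= t -> m (s + t) <= m s + m t.
  move=> t0; have [s0|s0] := leP s 0.
    by rewrite (m0 _ s0) add0r mhomo// gerDr.
  have st : 0 < s + t by rewrite ltr_wpDr.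
  have := mscale (s / (s + t)) (s + t); have := mscale (t / (s + t)) (s + t).
  rewrite !divfK ?gt_eqF// !divr_ge0 ?(ltW s0) ?(ltW st)//= !ler_pdivrMr//.
  rewrite !mul1r lerDl lerDr (ltW s0) t0 => /(_ isT) ht /(_ isT) hs.
  apply: le_trans (lerD hs ht).
  by rewrite -mulrDl -mulrDl divff ?gt_eqF// mul1r.
have cm : continuous m.
  move=> s; apply/cvgrPdist_le => e e0.
  have [d Aed] := Ae _ (divr_gt0 e0 (ltr0n _ 2)).
  have d0 : 0 < d by case: Aed.
  have small u : 0 <= u -> u <= d * (e / 2) -> m u <= e.
    move=> u0 ud; apply: (le_trans (mle u _ _ Aed)); rewrite (max_idPr u0).
    by rewrite [leRHS](splitr e) lerD2l ler_pdivrMr// mulrC.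
  have key a b : a <= b -> b - a <= d * (e / 2) -> `|m b - m a| <= e.
    move=> ab bad; have ba0 : 0 <= b - a by rewrite subr_ge0.
    have := msub a _ ba0; rewrite subrKC => mb.
    rewrite ger0_norm ?subr_ge0 ?mhomo// lerBlDl (le_trans mb)// lerD2l.
    exact: small.
  near=> t.
  have : `|s - t| <= d * (e / 2).
    by near: t; apply: cvgr_dist_le; [exact: cvg_id|rewrite mulr_gt0// divr_gt0].
  have [st|/ltW ts] := leP s t.
    by rewrite distrC ger0_norm ?subr_ge0// distrC; exact: key.
  by rewrite ger0_norm ?subr_ge0//; exact: key.
have [F [F0 FN dF]] := C1_even_primitive cm m0.
(* The factor 4 pays for two halvings: integrating only over [s / 2, s], and replacing m(s / 2) by
   m(s) / 2. *)
have dth (x : R) : is_derive x 1 (fun s => 4 * F s) (4 * (m x - m (- x))).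
  by have := @is_deriveZ _ _ _ F 4 x 1 _ (dF x).
(* Since m is nondecreasing and m (s / 2) >= m s / 2, the mean value theorem on
   [s / 2, s] bounds theta s = 4 F s below by s m(s). *)
have MV a b : 0 <= a -> a <= b -> 4 * m a * (b - a) <= 4 * F b - 4 * F a.
  move=> a0 ab.
  have [|c cab ->] := @MVT_segment R (fun s => 4 * F s) _ a b ab (fun x _ => dth x).
    apply: derivable_within_continuous => x _.
    by have [] := dth x.
  rewrite ler_wpM2r ?subr_ge0// ler_wpM2l//.
  move: cab; rewrite in_itv/= => /andP[ac cb].
  by rewrite (m0 (- c)) ?subr0 ?mhomo// oppr_le0 (le_trans a0).
exists (fun s => 4 * F s), (fun s => 4 * (m s - m (- s))), d1 => //; split.
- by rewrite F0 oppr0 subrr !mulr0.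
- by split=> [|x]; [exact: dth|rewrite FN].
- move=> x; apply: cvgM; first exact: cvg_cst.
  apply: cvgB; first exact: cm.
  exact: (continuous_comp (@oppr_continuous R R^o x) (cm (- x))).
- move=> x y x0 xy; rewrite -subr_ge0; apply: le_trans (MV _ _ x0 xy).
  by rewrite !mulr_ge0// subr_ge0.
- move=> x xd; set s := N x.
  have s0 : 0 <= s := N0 x.
  have s20 : 0 <= s / 2 by rewrite divr_ge0.
  have rm : `|r x| <= s * m s.
    have [sz|s_neq0] := eqVneq s 0.
      by have := rd1 x xd; rewrite -/s sz mulr0 mul0r.
    have s_gt0 : 0 < s by rewrite lt_neqAle eq_sym s_neq0.
    rewrite mulrC -ler_pdivrMr//; apply: lem => e d [e0 d0 red].
    (* If s <= d, the pair (e, d) bounds r directly; if d < s, then s / d > 1 and the pair (1, d1)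
       is enough. *)
    rewrite (max_idPr s0) ler_pdivrMr//; have [sd|ds] := leP s d.
      by rewrite (le_trans (red x sd))// ler_wpM2r// lerDl divr_ge0 ?ltW.
    rewrite (le_trans (rd1 x xd))// ler_wpM2r// ler_wpDl ?ltW//.
    by rewrite ltr_pdivlMr ?mul1r.
  have h1 : 4 * m 0 * (s / 2 - 0) <= 4 * F (s / 2) - 4 * F 0 by exact: MV.
  have h2 : 4 * m (s / 2) * (s - s / 2) <= 4 * F s - 4 * F (s / 2).
    by apply: MV => //; rewrite ler_pdivrMr// ler_peMr// ler1n.
  have h3 : 2^-1 * m s <= m (2^-1 * s) by apply: mscale; lra.
  rewrite m0// mulr0 mul0r F0 mulr0 subr0 in h1.
  rewrite (mulrC _ s) in h3.
  apply: (le_trans rm).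
  have : s * (2^-1 * m s) <= s * m (s / 2) by rewrite ler_wpM2l.
  nra.
Unshelve. all: by end_near. Qed.

(** * C^1 functions with explicit differentials *)

(** Keeping the differential as data lets sums and compositions deliver its formula together with
    the smoothness; the derivatives of the test function are then read off from it. *)
Definition is_C1_diff (R : realType) (U : normedModType R) (f : U -> R)
    (df : U -> U -> R) : Prop :=
  (forall p, is_diff p f (df p)) /\ (forall v, continuous (df^~ v)).

Lemma is_C1_diff_C1 (R : realType) (U : normedModType R) (f : U -> R)
    (df : U -> U -> R) : is_C1_diff f df -> C1 f.
Proof.
move=> [fd cd]; split=> [p|v]; first by have [] := fd p.
suff -> : (fun p => 'd f p v) = df^~ v by exact: cd.
by apply/funext => p; rewrite (@diff_val _ _ _ _ _ _ _ (fd p)).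
Qed.

Lemma is_C1_diffD (R : realType) (U : normedModType R) (f g : U -> R)
    (df dg : U -> U -> R) : is_C1_diff f df -> is_C1_diff g dg ->
  is_C1_diff (fun p => f p + g p) (fun p v => df p v + dg p v).
Proof.
move=> [fd cf] [gd cg]; split=> [p|v p]; first exact: is_diffD.
by apply: cvgD; [exact: cf|exact: cg].
Qed.

Lemma is_C1_diff_sum (R : realType) (U : normedModType R) (n : nat)
    (f : 'I_n -> U -> R) (df : 'I_n -> U -> U -> R) :
  (forall i, is_C1_diff (f i) (df i)) ->
  is_C1_diff (fun p => \sum_(i < n) f i p) (fun p v => \sum_(i < n) df i p v).
Proof.
elim: n f df => [f df _|n IH f df fd].
  split=> [p|v p].
    have -> : (fun p => \sum_(i < 0) f i p) = cst 0.
      by apply/funext => q; rewrite big_ord0.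
    have -> : (fun v => \sum_(i < 0) df i p v) = 0.
      by apply/funext => q; rewrite big_ord0.
    exact: is_diff_cst.
  have -> : (fun p => \sum_(i < 0) df i p v) = cst 0.
    by apply/funext => q; rewrite big_ord0.
  exact: cst_continuous.
have := is_C1_diffD (IH _ _ (fun i => fd (lift ord0 i))) (fd ord0).
congr is_C1_diff.
  by apply/funext => p; rewrite big_ord_recl addrC.
by apply/funext => p; apply/funext => v; rewrite big_ord_recl addrC.
Qed.

Lemma is_C1_diff_comp_linear (R : realType) (U : normedModType R)
    (l : {linear U -> R}) (f df : R -> R) :
  continuous l -> (forall x : R, is_derive x 1 f (df x)) -> continuous df ->
  is_C1_diff (fun p => f (l p)) (fun p v => l v * df (l p)).
Proof.
move=> cl fd cdf; split=> [p|v p].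
  have dfp : is_diff (l p) f ( *:%R^~ (df (l p))).
    have [fdp <-] := fd (l p); apply: DiffDef; first exact/derivable1_diffP.
    by rewrite deriv1E// derive1E.
  have dl : is_diff p l l.
    by apply: DiffDef; [exact: linear_differentiable|rewrite diff_lin].
  exact: (is_diff_comp dl dfp).
apply: cvgM; first exact: cvg_cst.
exact: (continuous_comp (cl p) (cdf (l p))).
Qed.

(** This is the shape of the test function built below. Separating the variables reduces smoothness
    to one-variable calculus and avoids the Euclidean norm, which is not differentiable at 0. *)
Lemma is_C1_diff_separable (R : realType) (n : nat) (a da : R -> R)
    (b db : 'I_n -> R -> R) :
  (forall t : R, is_derive t 1 a (da t)) -> continuous da ->
  (forall i (s : R), is_derive s 1 (b i) (db i s)) ->
  (forall i, continuous (db i)) ->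
  is_C1_diff
    (fun p : R * 'rV[R]_n => a p.1 + \sum_(i < n) b i (p.2 0 i))
    (fun p v => v.1 * da p.1 + \sum_(i < n) v.2 0 i * db i (p.2 0 i)).
Proof.
move=> ad cda bd cdb; apply: is_C1_diffD.
  by apply: (@is_C1_diff_comp_linear _ _ fst) => // p; exact: cvg_fst.
apply: is_C1_diff_sum => i.
have lin : linear (fun p : R * 'rV[R]_n => p.2 0 i : R).
  by move=> k u v; rewrite !mxE.
pose linM := GRing.isLinear.Build _ _ _ _ _ lin.
pose l : {linear (R * 'rV[R]_n)%type -> R} :=
  HB.pack (fun p : R * 'rV[R]_n => p.2 0 i) linM.
apply: (@is_C1_diff_comp_linear _ _ l) => // p.
apply: (@continuous_comp _ _ _ snd (fun y : 'rV[R]_n => y 0 i)).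
  exact: cvg_snd.
exact: coord_continuous.
Qed.

(** * Partial derivatives of test functions *)

Lemma derive_partial1 (R : realType) (n : nat) (psi : R * 'rV[R]_n -> R)
    (t : R) (z : 'rV[R]_n) :
  'D_1 (fun s : R => psi (s, z)) t = 'D_(1, 0) psi (t, z).
Proof.
rewrite /derive; set d := (fun _ : R => _ *: _); set d' := (fun _ : R => _ *: _).
suff -> : d = d' by [].
apply/funext => s; rewrite /d /d' /=.
by congr (_ *: (psi _ - _)); congr pair; rewrite /= scaler0 add0r.
Qed.

Lemma derive_partial2 (R : realType) (n : nat) (psi : R * 'rV[R]_n -> R)
    (t : R) (z v : 'rV[R]_n) :
  'D_v (fun y : 'rV[R]_n => psi (t, y)) z = 'D_(0, v) psi (t, z).
Proof.
rewrite /derive; set d := (fun _ : R => _ *: _); set d' := (fun _ : R => _ *: _).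
suff -> : d = d' by [].
apply/funext => s; rewrite /d /d' /=.
by congr (_ *: (psi _ - _)); congr pair; rewrite /= scaler0 add0r.
Qed.

Lemma dtau_psiE (R : realType) (n : nat) (psi : R * 'rV[R]_n -> R) tau z :
  differentiable psi (tau, z) -> dtau_psi psi tau z = 'd psi (tau, z) (1, 0).
Proof. by move=> dpsi; rewrite /dtau_psi derive1E derive_partial1 deriveE. Qed.

Lemma grad_psiE (R : realType) (n : nat) (psi : R * 'rV[R]_n -> R) tau z i :
  differentiable psi (tau, z) ->
  grad_psi psi tau z 0 i = 'd psi (tau, z) (0, delta_mx 0 i).
Proof. by move=> dpsi; rewrite mxE derive_partial2 deriveE. Qed.

Lemma C1N (R : realType) (U : normedModType R) (f : U -> R) :
  C1 f -> C1 (fun p => - f p).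
Proof.
move=> [df cf]; split=> [p|v]; first exact: differentiableN.
have -> : (fun p => 'd (fun q => - f q) p v) = (fun p => - 'd f p v).
  by apply/funext => p; rewrite (diffN (df p)).
by move=> p; apply: cvgN; exact: cf.
Qed.

Lemma dtau_psiN (R : realType) (n : nat) (psi : R * 'rV[R]_n -> R) tau z :
  differentiable psi (tau, z) ->
  dtau_psi (fun p => - psi p) tau z = - dtau_psi psi tau z.
Proof.
move=> dpsi; rewrite !dtau_psiE//; last exact: differentiableN.
by rewrite (diffN dpsi).
Qed.

Lemma grad_psiN (R : realType) (n : nat) (psi : R * 'rV[R]_n -> R) tau z :
  differentiable psi (tau, z) ->
  grad_psi (fun p => - psi p) tau z = - grad_psi psi tau z.
Proof.
move=> dpsi; have dN := differentiableN dpsi.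
apply/rowP => i; rewrite [RHS]mxE !grad_psiE//.
by rewrite (diffN dpsi).
Qed.

(** * Inner product and Euclidean norm *)

Lemma dotZl (R : realType) (n : nat) (k : R) (u v : 'rV[R]_n) :
  dot (k *: u) v = k * dot u v.
Proof. by rewrite /dot mulr_sumr; apply: eq_bigr => i _; rewrite mxE mulrA. Qed.

Lemma dot_delta (R : realType) (n : nat) (i : 'I_n) (v : 'rV[R]_n) :
  dot (delta_mx 0 i) v = v 0 i.
Proof.
rewrite /dot (bigD1 i)//= mxE !eqxx mul1r big1 ?addr0// => j ji.
by rewrite mxE (negbTE ji) andbF mul0r.
Qed.

Lemma dotNr (R : realType) (n : nat) (u v : 'rV[R]_n) : dot u (- v) = - dot u v.
Proof. by rewrite /dot -sumrN; apply: eq_bigr => i _; rewrite mxE mulrN. Qed.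

Lemma enorm_ge0 (R : realType) (n : nat) (u : 'rV[R]_n) : 0 <= enorm u.
Proof. exact: sqrtr_ge0. Qed.

Lemma enormZ (R : realType) (n : nat) (k : R) (u : 'rV[R]_n) :
  enorm (k *: u) = `|k| * enorm u.
Proof.
rewrite /enorm; have -> : dot (k *: u) (k *: u) = k ^+ 2 * dot u u.
  by rewrite dotZl /dot !mulr_sumr; apply: eq_bigr => i _; rewrite !mxE; ring.
by rewrite sqrtrM ?sqr_ge0// sqrtr_sqr.
Qed.

Lemma enorm_le_sum (R : realType) (n : nat) (u : 'rV[R]_n) :
  enorm u <= \sum_(i < n) `|u 0 i|.
Proof.
have S0 : 0 <= \sum_(i < n) `|u 0 i| by exact: sumr_ge0.
rewrite -[leRHS](ger0_norm S0) -sqrtr_sqr ler_sqrt ?sqr_ge0// /dot expr2 mulr_suml.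
apply: ler_sum => i _; apply: (le_trans (ler_norm _)); rewrite normrM ler_wpM2l//.
by rewrite (bigD1 i)//= lerDl sumr_ge0.
Qed.

(** * First-order expansions and touching test functions *)

(** The ci-expansion along one fixed path, [f t y] standing for phi(t, y, kappa_t): what follows is
    calculus in finitely many variables. *)
Definition first_order (R : realType) (n : nat) (T : R) (f : R -> 'rV[R]_n -> R)
    (tau : R) (z : 'rV[R]_n) (p : R) (q : 'rV[R]_n) : Prop :=
  forall eps : R, 0 < eps -> exists2 delta : R, 0 < delta &
  forall t y, t \in `[tau, T] -> `|t - tau| + enorm (y - z) <= delta ->
    `|f t y - f tau z - ((t - tau) * p + dot (y - z) q)|
      <= eps * (`|t - tau| + enorm (y - z)).

(** The test of the (sub) condition: up to a constant, f stays above psi. The (super) test is this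
    one for -f and -psi. *)
Definition touches_above (R : realType) (n : nat) (T : R)
    (f : R -> 'rV[R]_n -> R) (tau : R) (z : 'rV[R]_n) (psi : R * 'rV[R]_n -> R)
    (delta : R) : Prop :=
  forall t y, t \in `[tau, T] -> t <= tau + delta -> enorm (y - z) <= delta ->
    f tau z - psi (tau, z) <= f t y - psi (t, y).

Lemma first_orderN (R : realType) (n : nat) (T : R) (f : R -> 'rV[R]_n -> R)
    tau z p q : first_order T f tau z p q ->
  first_order T (fun t y => - f t y) tau z (- p) (- q).
Proof.
move=> fo e /fo[d d0 fod]; exists d => // t y tT yz.
by rewrite mulrN dotNr -!opprD normrN; exact: fod.
Qed.

(** Along the ray (tau + s dt, z + s v), s -> 0+, the difference quotients of psi are at most those
    of f, which tend to the right-hand side. The sign of dt keeps the ray inside [tau, T]. *)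
Lemma touching_diff_le (R : realType) (n : nat) (T : R)
    (f : R -> 'rV[R]_n -> R) tau z p q (psi : R * 'rV[R]_n -> R) delta :
  tau < T -> first_order T f tau z p q -> differentiable psi (tau, z) ->
  0 < delta -> touches_above T f tau z psi delta ->
  forall (dt : R) v, 0 <= dt -> 'd psi (tau, z) (dt, v) <= dt * p + dot v q.
Proof.
move=> tT fo dpsi delta0 tch dt v dt0.
apply/ler_addgt0Pr => e e0.
set K := dt + enorm v; have K0 : 0 <= K by rewrite addr_ge0 ?enorm_ge0.
have K1 : 0 < K + 1 by rewrite ltr_wpDl.
(* Half of e is for the remainder of f, half for the difference quotient of psi. K + 1 replaces the
   length K of (dt, v), which may be 0. *)
have [d d0 fod] := fo (e / 2 / (K + 1)) ltac:(by rewrite !divr_gt0).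
have dq : (s^-1 *: (psi (s *: (dt, v) + (tau, z)) - psi (tau, z)) : R)
    @[s --> 0^'+] --> 'd psi (tau, z) (dt, v).
  apply: cvg_dnbhs_at_right; rewrite -deriveE//.
  exact: (diff_derivable (v := (dt, v)) dpsi).
have small c : 0 < c -> \forall s \near 0^'+, s * (K + 1) <= c.
  move=> c0; near=> s; rewrite -ler_pdivlMr//; near: s.
  by apply: nbhs_right_le; rewrite divr_gt0.
near (0 : R)^'+ => s.
have s0 : 0 < s by near: s; exact: nbhs_right_gt.
have h1 : `|'d psi (tau, z) (dt, v) -
    s^-1 *: (psi (s *: (dt, v) + (tau, z)) - psi (tau, z))| <= e / 2.
  by near: s; apply: cvgr_dist_le => //; rewrite divr_gt0.
have h2 : s * (K + 1) <= d by near: s; exact: small.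
have h3 : s * (K + 1) <= delta by near: s; exact: small.
have h4 : s * (K + 1) <= T - tau by near: s; apply: small; rewrite subr_gt0.
have sdt : 0 <= s * dt by rewrite mulr_ge0// ltW.
have sv : 0 <= s * enorm v by rewrite mulr_ge0 ?enorm_ge0// ltW.
have sK : s * (K + 1) = s * dt + s * enorm v + s by rewrite /K; ring.
rewrite sK in h2 h3 h4.
have tin : s * dt + tau \in `[tau, T] by rewrite in_itv/=; apply/andP; split; lra.
have e1 : s * dt + tau - tau = s * dt by ring.
have e2 : s *: v + z - z = s *: v by rewrite addrK.
have ev : enorm (s *: v) = s * enorm v by rewrite enormZ gtr0_norm.
have := fod (s * dt + tau) (s *: v + z) tin.
have := tch (s * dt + tau) (s *: v + z) tin.
rewrite e1 e2 ev dotZl ger0_norm// => /(_ ltac:(lra) ltac:(lra)) h5.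
move=> /(_ ltac:(lra)); rewrite ler_norml => /andP[_ h6].
move: h1; rewrite ler_norml => /andP[_]; rewrite -[s *: (dt, v) + _]/(s * dt + tau, s *: v + z).
set D := 'd psi _ _; move=> h1; set P1 := psi (s * dt + tau, s *: v + z) in h1 h5 *.
have h7 : e / 2 / (K + 1) * (s * dt + s * enorm v) <= s * (e / 2).
  rewrite -mulrDr -/K mulrCA ler_pM2l// mulrAC ler_pdivrMr//.
  by rewrite ler_pM2l ?lerDl// divr_gt0.
have h8 : s * (D - e / 2) <= P1 - psi (tau, z).
  rewrite -ler_pdivlMl//; move: h1; rewrite /GRing.scale/=; lra.
have : s * D <= s * (dt * p + dot v q + e) by lra.
by rewrite ler_pM2l.
Unshelve. all: by end_near. Qed.

(** Time moves only forward, which leaves an inequality; at dt = 0 both v and -v are allowed, which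
    forces equality. *)
Lemma touching_grad_eq (R : realType) (n : nat) (T : R)
    (f : R -> 'rV[R]_n -> R) tau z p q (psi : R * 'rV[R]_n -> R) delta :
  tau < T -> first_order T f tau z p q -> differentiable psi (tau, z) ->
  0 < delta -> touches_above T f tau z psi delta ->
  dtau_psi psi tau z <= p /\ grad_psi psi tau z = q.
Proof.
move=> tT fo dpsi delta0 tch.
have H := touching_diff_le tT fo dpsi delta0 tch.
split.
  rewrite dtau_psiE//; have := H 1 0 ler01.
  by rewrite mul1r -(scale0r 0) dotZl mul0r addr0.
apply/rowP => i; rewrite grad_psiE//; apply/eqP; rewrite eq_le.
have := H 0 (delta_mx 0 i) (lexx _); rewrite mul0r add0r dot_delta => ->/=.
have := H 0 (- delta_mx 0 i) (lexx _); rewrite mul0r add0r -scaleN1r dotZl dot_delta.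
have -> : (0, -1 *: delta_mx 0 i) = - (0, delta_mx 0 i) :> R * 'rV[R]_n.
  by rewrite scaleN1r; congr pair; rewrite oppr0.
by rewrite linearN mulN1r lerN2.
Qed.

(** psi is the affine part of the expansion minus one penalty [th] for each coordinate of (t, y).
    The penalties vanish to first order at (tau, z), so the derivatives of psi are p and q there,
    and their sum dominates the remainder. *)
Lemma exists_C1_touching (R : realType) (n : nat) (T : R)
    (f : R -> 'rV[R]_n -> R) tau z p q :
  first_order T f tau z p q ->
  exists psi : R * 'rV[R]_n -> R, exists2 delta : R, 0 < delta &
  [/\ C1 psi, dtau_psi psi tau z = p, grad_psi psi tau z = q &
      touches_above T f tau z psi delta].
Proof.
move=> fo.
pose N (x : R * 'rV[R]_n) := `|x.1 - tau| + enorm (x.2 - z).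
pose lin (x : R * 'rV[R]_n) := (x.1 - tau) * p + dot (x.2 - z) q.
(* The expansion is known only for t in [tau, T]; the value 0 elsewhere makes the bound hold at all
   points. *)
pose r (x : R * 'rV[R]_n) :=
  if x.1 \in `[tau, T] then f x.1 x.2 - f tau z - lin x else 0.
have N0 x : 0 <= N x by rewrite addr_ge0 ?enorm_ge0.
have rN e : 0 < e -> exists2 d, 0 < d & forall x, N x <= d -> `|r x| <= e * N x.
  move=> e0; have [d d0 dP] := fo e e0; exists d => // x xd; rewrite /r.
  by case: ifPn => xT; [exact: dP|rewrite normr0 mulr_ge0// ltW].
have [th [dth [d d0 [[th0 dth0] [dth1 thN] cdth thmono thr]]]] :=
  C1_majorant N0 rN.
pose M : R := n.+1%:R; have M0 : 0 < M by rewrite ltr0n.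
pose c (u k s : R) := k * (s - u) - th (M * (s - u)).
pose dc (u k s : R) := k - M * dth (M * (s - u)).
have thabs s : th `|s| = th s.
  by have [/ger0_norm->//|/ltr0_norm->] := leP 0 s; rewrite thN.
have th_ge0 s : 0 <= th s by rewrite -thabs -th0 thmono.
have cdc u k : continuous (dc u k).
  move=> s; apply: cvgB; first exact: cvg_cst.
  apply: cvgM; first exact: cvg_cst.
  apply: (@continuous_comp _ _ _ (fun s : R => M * (s - u)) dth _ _ (cdth _)).
  apply: cvgM; first exact: cvg_cst.
  by apply: cvgB; [exact: cvg_id|exact: cvg_cst].
have dcP u k (s : R) : is_derive s 1 (c u k) (dc u k s).
  have dZ (a : R) : is_derive s 1 (fun s : R => a * (s - u)) a.
    have := is_deriveZ a (is_deriveB (is_derive_id s 1) (is_derive_cst u s 1)).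
    by rewrite subr0 [_ *: 1]mulr1.
  have dth_s := @is_derive1_comp R th _ s _ _ (dth1 _) (dZ M).
  by have := is_deriveB (dZ k) dth_s; rewrite /dc (mulrC M (dth _)).
have Cpsi := is_C1_diff_separable (dcP tau p) (cdc tau p)
  (fun i => dcP (z 0 i) (q 0 i)) (fun i => cdc (z 0 i) (q 0 i)).
set psi := (fun x : R * 'rV[R]_n => _) in Cpsi.
have C1psi := is_C1_diff_C1 Cpsi.
have dpsi : differentiable psi (tau, z) by case: C1psi.
have dpsiE v : 'd psi (tau, z) v = v.1 * p + dot v.2 q.
  rewrite (@diff_val _ _ _ _ _ _ _ (Cpsi.1 (tau, z)))/= /dc !subrr !mulr0.
  rewrite dth0 mulr0 subr0; congr (_ + _); apply: eq_bigr => i _.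
  by rewrite subrr mulr0 dth0 mulr0 subr0.
(* Two increments of size at most d / 2, in time and in space, keep N within d. *)
exists psi, (d / 2); first exact: divr_gt0.
split => //.
- by rewrite dtau_psiE// dpsiE/= mul1r -(scale0r 0) dotZl mul0r addr0.
- by apply/rowP => i; rewrite grad_psiE// dpsiE/= mul0r add0r dot_delta.
- move=> t y tT td yd.
  have psi0 : psi (tau, z) = 0.
    rewrite /psi /c/= !subrr !mulr0 th0 subrr add0r big1// => i _.
    by rewrite subrr !mulr0 th0 subrr.
  have psiE : psi (t, y) = lin (t, y) -
      (th (M * (t - tau)) + \sum_(i < n) th (M * (y 0 i - z 0 i))).
    rewrite /psi /lin /c/= /dot sumrB.
    rewrite [X in _ = _ + X - _](_ : _ = \sum_(i < n) q 0 i * (y 0 i - z 0 i)).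
      by ring.
    by apply: eq_bigr => i _; rewrite !mxE mulrC.
  have thM s : th (M * s) = th (M * `|s|).
    by have [/ger0_norm->//|/ltr0_norm->] := leP 0 s; rewrite mulrN thN.
  have th_split : th (N (t, y)) <=
      th (M * (t - tau)) + \sum_(i < n) th (M * (y 0 i - z 0 i)).
    (* One of the n + 1 coordinate increments is at least N / M, M = n + 1. *)
    have [le_t|lt_t] := leP (N (t, y)) (M * `|t - tau|).
      apply: (le_trans (thmono _ _ (N0 _) le_t)).
      by rewrite -thM lerDl sumr_ge0.
    have [[i le_i]|ngt] := pselect (exists i, N (t, y) <= M * `|y 0 i - z 0 i|).
      apply: (le_trans (thmono _ _ (N0 _) le_i)).
      by rewrite -thM (bigD1 i)//= addrCA lerDl addr_ge0// sumr_ge0.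
    (* If all n + 1 increments were below N / M, adding them up would give M N < M N, since N is at
       most the sum of their absolute values. *)
    have sum_le : \sum_(i < n) M * `|y 0 i - z 0 i| <= n%:R * N (t, y).
      rewrite -[n in n%:R]card_ord mulr_natl -sumr_const ler_sum// => i _.
      by rewrite leNgt; apply/negP => /ltW lei; apply: ngt; exists i.
    have enorm_le := enorm_le_sum (y - z).
    have enormM : M * enorm (y - z) <= \sum_(i < n) M * `|y 0 i - z 0 i|.
      rewrite -mulr_sumr ler_pM2l//; apply: (le_trans enorm_le).
      by apply: ler_sum => i _; rewrite !mxE.
    have MN : M * N (t, y) = M * `|t - tau| + M * enorm (y - z) by rewrite -mulrDr.
    have : M * N (t, y) = N (t, y) + n%:R * N (t, y) by rewrite /M -natr1; ring.
    by lra.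
  have t_ge : 0 <= t - tau.
    by move: tT; rewrite in_itv/= subr_ge0 => /andP[].
  have Nd : N (t, y) <= d by rewrite /N/= ger0_norm//; lra.
  have := thr (t, y) Nd; rewrite /r/= tT ler_norml => /andP[+ _].
  by rewrite psi0 psiE; lra.
Qed.

(** * The constant extension and the reduction to functions of (t, y) *)

Lemma lambda0_nonempty (R : realType) (n I : nat) (h tau : R) (z : 'rV[R]_n)
    (w : R -> 'rV[R]_n) :
  0 < h -> tau < horizon I h -> PLip h w -> exists kappa, Lambda0 I h tau z w kappa.
Proof.
move=> h0 tT [w0 [s [ps ws]]].
(* Before tau - h this is 0 because w vanishes off [-h, 0[; after the horizon, the extension by zero
   has to be imposed. *)
pose kappa t := if t < tau then w (t - tau) else
  if t <= horizon I h then z else 0.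
have ps' : itv_partition (tau - h) tau [seq x + tau | x <- s].
  case: ps => sp /eqP sl; rewrite (addrC tau); split; last first.
    by rewrite (last_map (fun x => x + tau) s (- h)) sl add0r.
  rewrite (map_path (h := fun x => x + tau) (e' := <%O) (b := pred0)) ?has_pred0//.
  by move=> x y _; rewrite /= ltrD2r.
(* Up to index [size s] the entries lie in the shifted partition, so the two different defaults are
   never read. *)
have nths i : (i < (size s).+1)%N ->
    nth (horizon I h) (tau - h :: [seq x + tau | x <- s] ++ [:: horizon I h]) i
    = nth 0 (- h :: s) i + tau.
  move=> si; rewrite -cat_cons nth_cat/= size_map si.
  by rewrite addrC -(map_cons (fun x => x + tau)) (nth_map 0).
exists kappa; split; last first.
  by move=> t; rewrite in_itv/= /kappa ltNge => /andP[-> ->].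
split.
- split.
    move=> t /negP; rewrite in_itv/= negb_and -!ltNge /kappa => /orP[th|Tt].
      have -> : t < tau by rewrite (lt_trans th)// ltrBlDr ltrDl.
      by apply: w0; apply/negP; rewrite in_itv/= negb_and -ltNge ltrBlDr addrC th.
    by rewrite ltNge (ltW (lt_trans tT Tt))/= leNgt Tt.
  (* The breakpoints of w shifted by tau, then one more interval from tau to the horizon, on which
     kappa is constant. *)
  exists ([seq x + tau | x <- s] ++ [:: horizon I h]); split.
    exact: (itv_partition_cat ps' (itv_partition1 tT)).
  move=> i; rewrite size_cat size_map addn1 ltnS leq_eqVlt => /orP[/eqP ->|si].
    rewrite nths// (itv_partition_nth_size 0 ps) add0r.
    rewrite /= nth_cat size_map ltnn subnn/=.
    exists 0; split=> // M M0 -[x y]/= [xT yT].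
    have kz u : u \in `[tau, horizon I h[ -> kappa u = z.
      rewrite in_itv/= => /andP[tu /ltW uT].
      by rewrite /kappa ltNge tu uT.
    by rewrite !kz// subrr normr0 mulr_ge0// ltW.
  rewrite !nths//; last by rewrite ltnS ltnW.
  have [M [Mr wM]] := ws i si; exists M; split=> // K /wM wK -[x y]/= [xi yi].
  have kw u : u \in `[nth 0 (- h :: s) i + tau, nth 0 (- h :: s) i.+1 + tau[ ->
      kappa u = w (u - tau) /\ u - tau \in `[nth 0 (- h :: s) i, nth 0 (- h :: s) i.+1[.
    rewrite !in_itv/= lerBrDr ltrBlDr => ui; split=> //; rewrite /kappa.
    case/andP: ui => _ ui; rewrite (lt_le_trans ui)// gerDr.
    exact: (itv_partition_nth_le (m := i.+1) _ ps).
  have [-> xi'] := kw x xi; have [-> yi'] := kw y yi.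
  have := wK (x - tau, y - tau) (conj xi' yi').
  by rewrite /= opprB addrA subrK.
- by rewrite /kappa ltxx (ltW tT).
- by move=> t; rewrite in_itv/= /kappa => /andP[_ ->].
Qed.

(** Both sides vanish off [-h, 0[, so they agree as functions on all of R, and phi takes the same
    value on them. *)
Lemma segment_at_start (R : realType) (n I : nat) (h tau : R) (z : 'rV[R]_n)
    (w x : R -> 'rV[R]_n) :
  PLip h w -> Lambda I h tau z w x -> segment_at h x tau = w.
Proof.
move=> [w0 _] [_ _ xw]; apply/funext => s; rewrite /segment_at /patch.
case: ifPn => [|/negP] sh; last by rewrite w0// => sh'; apply: sh; rewrite inE.
move: sh; rewrite inE/= in_itv/= => /andP[hs s0].
rewrite xw; first by rewrite addrC addKr.
by rewrite in_itv/= gtrDl lerD2l hs.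
Qed.

Lemma ci_derivative_first_order (R : realType) (n I : nat) (h : R)
    (phi : R -> 'rV[R]_n -> (R -> 'rV[R]_n) -> R) tau z w kappa p q :
  PLip h w -> Lambda I h tau z w kappa ->
  is_ci_derivative I h phi tau z w p q ->
  first_order (horizon I h) (fun t y => phi t y (segment_at h kappa t))
    tau z p q.
Proof.
move=> wP kP ci; rewrite /first_order (segment_at_start wP kP).
exact: ci.
Qed.

Lemma touches_aboveP (R : realType) (n I : nat) (h : R)
    (phi : R -> 'rV[R]_n -> (R -> 'rV[R]_n) -> R) tau z w kappa psi delta :
  PLip h w -> Lambda I h tau z w kappa ->
  touches_above (horizon I h) (fun t y => phi t y (segment_at h kappa t))
    tau z psi delta <->
  (forall t x, Oplus I h delta tau z (t, x) ->
     phi tau z w - psi (tau, z) <= phi t x (segment_at h kappa t) - psi (t, x)).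
Proof.
move=> wP kP; rewrite /touches_above (segment_at_start wP kP).
split=> [H t x [/=]|H t x].
  by rewrite !in_itv/= => /andP[tt td] tT xz; apply: H; rewrite ?in_itv/= ?tt.
rewrite in_itv/= => /andP[tt tT] td xz; apply: H; split=> //=.
by rewrite in_itv/= tt.
Qed.

Lemma Gstar_lt_horizon (R : realType) (n I : nat) (h tau : R) (z : 'rV[R]_n)
    (w : R -> 'rV[R]_n) : 0 < h -> Gstar I h tau z w -> tau < horizon I h.
Proof.
move=> h0 [[i [iI /andP[_ ti]]] _]; apply: (lt_le_trans ti).
by rewrite /horizon ler_pM2r// ler_nat.
Qed.

(** * From viscosity inequalities to the equation and back *)

Lemma viscosity_ci_derivative (R : realType) (n I : nat) (h : R) g H
    (phi : R -> 'rV[R]_n -> (R -> 'rV[R]_n) -> R) tau z w p q :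
  0 < h -> viscosity_sub I h g H phi -> viscosity_super I h g H phi ->
  Gstar I h tau z w -> is_ci_derivative I h phi tau z w p q ->
  HJ_lhs h g H tau z w p q = 0.
Proof.
move=> h0 sub super G ci.
have tT := Gstar_lt_horizon h0 G.
have wP : PLip h w by case: G => _ [].
have [kappa k0] := lambda0_nonempty z h0 tT wP.
have kP : Lambda I h tau z w kappa by case: k0.
have fo := ci_derivative_first_order wP kP ci.
apply/eqP; rewrite eq_le; apply/andP; split.
  have [psi [d d0 [C1psi <- <- tch]]] := exists_C1_touching fo.
  by apply: (sub _ _ _ _ d kappa) => //; apply/touches_aboveP.
(* The expansion of -f has coefficients -p and -q; the negative of the test function it yields
   touches f from above with derivatives p and q. *)
have [psi [d d0 [C1psi dt gr tch]]] :=
  exists_C1_touching (first_orderN fo).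
have dpsi : differentiable psi (tau, z) by case: C1psi.
rewrite -(opprK p) -(opprK q) -dt -gr -dtau_psiN// -grad_psiN//.
apply: (super tau z w _ d kappa G (C1N C1psi) d0 k0).
move=> t x O; rewrite !opprK.
have /(_ t x O) := (touches_aboveP
  (fun t y v => - phi t y v) _ _ wP kP).1 tch.
by lra.
Qed.

Lemma ci_derivativesP (R : realType) (n I : nat) (h : R)
    (phi : R -> 'rV[R]_n -> (R -> 'rV[R]_n) -> R) tau z w :
  ci_differentiable I h phi tau z w ->
  is_ci_derivative I h phi tau z w (ci_dtau I h phi tau z w)
    (ci_grad I h phi tau z w).
Proof.
move=> [p [q pq]].
exact: (@xgetPex _ (0, 0)
  [set pq | is_ci_derivative I h phi tau z w pq.1 pq.2] (ex_intro _ (p, q) pq)).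
Qed.

(** Once the gradient of psi is identified with q, the two left-hand sides of (HJ) differ only in
    the time derivative, where [dtau_psi] is at most p. *)
Lemma HJ_viscosity_sub (R : realType) (n I : nat) (h : R) g H
    (phi : R -> 'rV[R]_n -> (R -> 'rV[R]_n) -> R) :
  0 < h ->
  (forall tau z w, Gstar I h tau z w -> exists p q,
     is_ci_derivative I h phi tau z w p q /\ HJ_lhs h g H tau z w p q <= 0) ->
  viscosity_sub I h g H phi.
Proof.
move=> h0 HJ tau z w psi d kappa G [C1psi _] d0 [kP _] tch.
have wP : PLip h w by case: G => _ [].
have [p [q [ci HJ0]]] := HJ _ _ _ G.
have fo := ci_derivative_first_order wP kP ci.
have [dt ->] := touching_grad_eq
  (Gstar_lt_horizon h0 G) fo (C1psi _) d0
  ((touches_aboveP phi _ _ wP kP).2 tch).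
by apply: le_trans HJ0; rewrite !lerD2r.
Qed.

(** The same comparison for -f and -psi: the gradient is again q, and now p is at most
    [dtau_psi]. *)
Lemma HJ_viscosity_super (R : realType) (n I : nat) (h : R) g H
    (phi : R -> 'rV[R]_n -> (R -> 'rV[R]_n) -> R) :
  0 < h ->
  (forall tau z w, Gstar I h tau z w -> exists p q,
     is_ci_derivative I h phi tau z w p q /\ 0 <= HJ_lhs h g H tau z w p q) ->
  viscosity_super I h g H phi.
Proof.
move=> h0 HJ tau z w psi d kappa G [C1psi _] d0 [kP _] tch.
have wP : PLip h w by case: G => _ [].
have [p [q [ci HJ0]]] := HJ _ _ _ G.
have fo := first_orderN
  (ci_derivative_first_order wP kP ci).
have tchN : touches_above (horizon I h)
    (fun t y => - phi t y (segment_at h kappa t)) tau z (fun x => - psi x) d.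
  apply/(touches_aboveP (fun t y v => - phi t y v) _ _ wP kP).
  by move=> t x /tch; lra.
have [] := touching_grad_eq
  (Gstar_lt_horizon h0 G) fo (differentiableN (C1psi _)) d0 tchN.
rewrite dtau_psiN// grad_psiN// lerN2 => dt /oppr_inj ->.
by apply: (le_trans HJ0); rewrite !lerD2r.
Qed.

Unset Implicit Arguments.

Theorem theorem5 (R : realType) (n I : nat) (h : R)
    (g : R -> 'rV[R]_n -> 'rV[R]_n)
    (H : R -> 'rV[R]_n -> 'rV[R]_n -> 'rV[R]_n -> R)
    (sigma : 'rV[R]_n -> (R -> 'rV[R]_n) -> R)
    (hn : (0 < n)%N) (hI : (0 < I)%N) (hh : 0 < h)
    (Hg : cond_g I h g) (HH1 : cond_H1 I h H) (HH2 : cond_H2 I h H)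
    (HH3 : cond_H3 I h H) (Hsigma : cond_sigma h sigma) :
  (forall phi : R -> 'rV[R]_n -> (R -> 'rV[R]_n) -> R,
     viscosity_solution I h g H sigma phi ->
     forall (tau : R) (z : 'rV[R]_n) (w : R -> 'rV[R]_n),
       Gstar I h tau z w -> ci_differentiable I h phi tau z w ->
       HJ_at I h g H phi tau z w)
  /\
  (forall phi : R -> 'rV[R]_n -> (R -> 'rV[R]_n) -> R,
     (forall (tau : R) (z : 'rV[R]_n) (w : R -> 'rV[R]_n),
        Gstar I h tau z w -> ci_differentiable I h phi tau z w) ->
     (forall (tau : R) (z : 'rV[R]_n) (w : R -> 'rV[R]_n),
        Gstar I h tau z w -> HJ_at I h g H phi tau z w) ->
     cond_phi1 I h phi -> cond_phi2 I h phi -> terminal_cond I h sigma phi ->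
     viscosity_solution I h g H sigma phi).
Proof.
split=> [phi [_ _ _ sub super] tau z w G /ci_derivativesP ci|].
  exact: (viscosity_ci_derivative hh sub super G ci).
move=> phi ci HJ phi1 phi2 term; split=> //.
  apply: HJ_viscosity_sub => // tau z w G; have /ci_derivativesP cid := ci _ _ _ G.
  by do 2!eexists; split; [exact: cid|have := HJ _ _ _ G; rewrite /HJ_at => ->].
apply: HJ_viscosity_super => // tau z w G; have /ci_derivativesP cid := ci _ _ _ G.
by do 2!eexists; split; [exact: cid|have := HJ _ _ _ G; rewrite /HJ_at => ->].
Qed.
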